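(* Let $\mathcal{R}$ be a set of $k$-subsets of $\mathbb{Z}_n$ in which each $t$-subset of $\mathbb{Z}_n$ is contained in at most one $k$-subset of $\mathcal{R}$. Let $\mathcal{T}=\{\mathcal{T}_1,\mathcal{T}_2,\ldots,\mathcal{T}_r\}$ be a set that contains $r$ subsets, where each $\mathcal{T}_i$ is a Steiner system $\mathrm{S}(t-1,k-1,n)$ on $\mathbb{Z}_n$ and each two distinct $\mathcal{T}_i$'s are disjoint. Moreover, assume that each $t$-subset of $\mathbb{Z}_n$ which is not contained in a $k$-subset of $\mathcal{R}$ is contained in (a block of) exactly one of the $\mathcal{T}_i$'s. Let $\mathcal{S}'$ be the system on $\mathbb{Z}_2^n\times\mathbb{Z}_{r+1}$ whose blocks are the elements of $$B_1=\{\{x_1,x_2,\ldots,x_k\} : \{x_1,x_2,\ldots,x_k\}\in\mathcal{R}\}$$ and $$B_2=\{\{x_1,x_2,\ldots,x_{k-1},(n+1,i)\} : \{x_1,x_2,\ldots,x_{k-1}\}\in\mathcal{T}_i,\ 1\le i\le r\}.$$ Then $\mathcal{S}'$ is an $\mathrm{MS}(t,k,\mathbb{Z}_2^n\times\mathbb{Z}_{r+1})$.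
   Context: A Steiner system $\mathrm{S}(t,k,n)$ on an $n$-set is a collection of $k$-subsets (blocks) of the $n$-set such that each $t$-subset of the $n$-set is contained in exactly one block. A mixed Steiner system $\mathrm{MS}(t,k,Q)$ over the mixed alphabet $Q=\mathbb{Z}_{q_1}\times\mathbb{Z}_{q_2}\times\cdots\times\mathbb{Z}_{q_N}$ is a pair $(Q,\mathcal{C})$, where $\mathcal{C}$ is a set of codewords (blocks) of weight $k$ over $Q$ (the weight of a word is its number of nonzero coordinates), such that for each word $x$ of weight $t$ over $Q$ there exists exactly one codeword $c\in\mathcal{C}$ that covers $x$, i.e., $d(x,c)=k-t$, where $d$ is the Hamming distance, and the minimum Hamming distance of the code $\mathcal{C}$ is $2(k-t)+1$. If all the $q_i$'s are equal, then the design is a Steiner system when all the $q_i$'s equal 2, and a generalized Steiner system when all the $q_i$'s are equal and greater than 2. Representation of words as sets: a word over $Q$ is identified with the set of pairs $(i,\alpha)$ such that the nonzero letter $\alpha$ is in its $i$-th coordinate; for binary coordinates one writes $i$ instead of $(i,1)$. Over $\mathbb{Z}_2^n\times\mathbb{Z}_{r+1}$, the $n$ binary coordinates are indexed by the elements of $\mathbb{Z}_n$, and $(n+1,\alpha)$ means that the last coordinate (over $\mathbb{Z}_{r+1}$) contains the nonzero letter $\alpha$.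
   Formalization: Added: a t-subset contained in a block of R is in no block of any T_i (without this the claim fails, e.g. n=4, t=2, k=3, r=3, R={123}). Minimum distance exactly 2(k-t)+1 is claimed only for r≥2; for r≤1 only as a lower bound, since equal-weight binary words have even distances. *)

(* Defs.v *)
From HB Require Import structures.
From mathcomp Require Import all_boot.
Set Implicit Arguments.
Unset Strict Implicit.
Unset Printing Implicit Defensive.

Definition covered (T : finType) (X : {set T}) (B : {set {set T}}) : Prop :=
  exists2 A : {set T}, A \in B & X \subset A.

Definition steiner_system (T : finType) (t k : nat) (B : {set {set T}}) : Prop :=
  (forall A : {set T}, A \in B -> #|A| = k) /\
  (forall X : {set T}, #|X| = t ->
     exists! A : {set T}, A \in B /\ X \subset A).

(* Words over the product of the Z_(q i). Only the distinction between zero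
   and the nonzero letters matters, so Z_m is taken to be 'I_m: this is right
   for every m, whereas 'Z_m has two elements when m = 1. *)
Definition word (I : finType) (q : I -> nat) : finType :=
  {dffun forall i : I, 'I_(q i)}.

Definition weight (I : finType) (q : I -> nat) (x : word q) : nat :=
  #|[set i : I | (x i : nat) != 0]|.

Definition hamming (I : finType) (q : I -> nat) (x y : word q) : nat :=
  #|[set i : I | x i != y i]|.

Definition distance_ge (I : finType) (q : I -> nat) (C : {set word q})
    (d : nat) : Prop :=
  forall c c' : word q, c \in C -> c' \in C -> c != c' -> d <= hamming c c'.

Definition min_distance (I : finType) (q : I -> nat) (C : {set word q})
    (d : nat) : Prop :=
  distance_ge C d /\
  (exists c c' : word q, [/\ c \in C, c' \in C, c != c' & hamming c c' = d]).

(* The minimum distance is exactly 2(k-t)+1 as soon as some alphabet has more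
   than two letters. Binary words of equal weight are at even distance, so in
   the all-binary case, where the systems are to be the ordinary Steiner
   systems, "minimum distance 2(k-t)+1" can only be a lower bound. *)
Definition mixed_steiner_system (I : finType) (q : I -> nat) (t k : nat)
    (C : {set word q}) : Prop :=
  [/\ forall c : word q, c \in C -> weight c = k,
      forall x : word q, weight x = t ->
        exists! c : word q, c \in C /\ hamming x c = k - t,
      distance_ge C (2 * (k - t) + 1)
    & (exists i : I, 2 < q i) -> min_distance C (2 * (k - t) + 1)].

(* The alphabet Z_2^n x Z_(r+1): the binary coordinates are the Some j with
   j : 'I_n, and None is the last coordinate. *)
Definition alphabet (n r : nat) (i : option 'I_n) : nat :=
  if i is Some _ then 2 else r.+1.

(* The word with binary support A and last letter a; it represents the set
   A when a = 0, and A together with (n+1, a) otherwise. *)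
Definition word_of (n r : nat) (A : {set 'I_n}) (a : 'I_r.+1) :
    word (@alphabet n r) :=
  [ffun i : option 'I_n =>
     match i return 'I_(alphabet r i) with
     | Some j => if j \in A then ord_max : 'I_2 else ord0 : 'I_2
     | None => a
     end].

(* T i carries the letter i + 1, that is, lift ord0 i, because the indices
   i : 'I_r start at 0. *)
Definition extended_blocks (n r : nat) (R : {set {set 'I_n}})
    (T : 'I_r -> {set {set 'I_n}}) : {set word (@alphabet n r)} :=
  [set word_of A (ord0 : 'I_r.+1) | A : {set 'I_n} in R] :|:
  \bigcup_(i : 'I_r) [set word_of A (lift ord0 i) | A : {set 'I_n} in T i].

(* Main.v *)
Require Import Defs.
From HB Require Import structures.
From mathcomp Require Import all_boot.
From mathcomp Require Import zify.
Set Implicit Arguments.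
Unset Strict Implicit.
Unset Printing Implicit Defensive.

(** Sort the blocks by their last letter: letter [0] carries the family [R] and
    letter [i + 1] the family [T i].  A block with binary support [A] and last
    letter [a] then has [#|A| + (a != 0) = k], and two such blocks are at
    distance [#|A| + #|B| - 2 * #|A :&: B| + (a != b)].  Everything is therefore
    governed by the size of [A :&: B], and the hypotheses say two things about
    it.  Two blocks whose supports share [t] points are equal
    ([block_determined_by_tset]): within [R] this is the packing property,
    between [R] and [T i] it is [T_avoids], between [T i] and [T j] it is the
    uniqueness in [T_covers].  And two blocks with the same nonzero letter are
    equal as soon as they share [t - 1] points, since [T i] is a Steiner system
    ([block_determined_by_pred_tset]).

    The distance bound is then a count in three cases.  With different letters
    at most two units of weight sit on the last coordinate and the supports
    share at most [t - 1] points, which gives [2 (k - 1) - 2 (t - 1) + 1]; with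
    common letter [0] it gives [2 k - 2 (t - 1)], and with a common nonzero
    letter [2 (k - 1) - 2 (t - 2)].  The first value is reached when there are
    two nonzero letters: take the blocks of both letters through the same
    [t - 1] points.

    A word of weight [t] is at distance [k - t] from a word of weight [k]
    exactly when it is contained in it as a set ([hamming_eq_cover]).  If its
    last letter is nonzero, its other [t - 1] points lie in one block of the
    Steiner system of that letter; if it is [0], its [t] points lie in a block
    of [R] or of some [T i], and in only one. *)

(** * Words as a binary support with a last letter *)

Lemma exists_subset_card (I : finType) (m : nat) (A : {set I}) :
  m <= #|A| -> exists2 X : {set I}, X \subset A & #|X| = m.
Proof.
rewrite -bin_gt0 -cards_draws => /card_gt0P[X].
by rewrite inE => /andP[sXA /eqP cX]; exists X.
Qed.

Lemma card_option_set (I : finType) (P : pred (option I)) :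
  #|[set i | P i]| = #|[set j | P (Some j)]| + P None.
Proof.
rewrite (cardsD1 None) inE addnC; congr (_ + _).
rewrite -[#|[set j | P (Some j)]|](card_imset _ (@Some_inj _)); apply: eq_card => -[j|]; rewrite !inE /=.
  by rewrite mem_imset ?inE //; apply: Some_inj.
by apply/esym/imsetP => -[].
Qed.

Lemma weight_word_of (n r : nat) (A : {set 'I_n}) (a : 'I_r.+1) :
  weight (word_of A a) = #|A| + (a != ord0).
Proof.
rewrite /weight card_option_set ffunE; congr (_ + _).
by apply: eq_card => j; rewrite inE ffunE; case: (j \in A).
Qed.

Lemma hamming_word_of (n r : nat) (A B : {set 'I_n}) (a b : 'I_r.+1) :
  hamming (word_of A a) (word_of B b) + 2 * #|A :&: B|
    = #|A| + #|B| + (a != b).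
Proof.
rewrite /hamming card_option_set !ffunE.
have -> : [set j | word_of A a (Some j) != word_of B b (Some j)]
            = (A :\: B) :|: (B :\: A).
  by apply/setP => j; rewrite !inE !ffunE; case: (j \in A); case: (j \in B).
rewrite cardsU (_ : (A :\: B) :&: (B :\: A) = set0); last first.
  by apply/setP => j; rewrite !inE; case: (j \in A); rewrite ?andbF.
rewrite cards0 subn0 -(cardsID B A) -(cardsID A B) (setIC B A).
have e x y z w : x + y + w + 2 * z = z + x + (z + y) + w by lia.
exact: e.
Qed.

Lemma word_of_surj (n r : nat) (x : word (@alphabet n r)) :
  exists A : {set 'I_n}, exists a : 'I_r.+1, x = word_of A a.
Proof.
exists [set j | (x (Some j) : nat) != 0], (x None).
apply/ffunP => -[j|]; rewrite ffunE // inE; apply: val_inj => /=.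
by case: (x (Some j)) => -[|[|m]].
Qed.

Lemma word_of_inj (n r : nat) (A B : {set 'I_n}) (a b : 'I_r.+1) :
  word_of A a = word_of B b -> A = B /\ a = b.
Proof.
move=> /ffunP e; split; last by move: (e None); rewrite !ffunE.
apply/setP => j; move: (e (Some j)); rewrite !ffunE.
by case: (j \in A); case: (j \in B).
Qed.

(** The distance is at least the difference [k - t] of the weights, with
    equality only for containment.  The letter condition reads: the last letter
    of the smaller word is blank or the same as that of the larger one. *)
Lemma hamming_eq_cover (n r t k : nat) (X A : {set 'I_n}) (a b : 'I_r.+1) :
  t <= k -> #|X| + (a != ord0) = t -> #|A| + (b != ord0) = k ->
  hamming (word_of X a) (word_of A b) = k - t <->
  X \subset A /\ (a = ord0 \/ a = b).
Proof.
move=> le_tk cX cA; have h := hamming_word_of X A a b.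
have le_cap : #|X :&: A| <= #|X| by apply/subset_leq_card/subsetIl.
have sub_cap : X \subset A <-> #|X :&: A| = #|X|.
  split=> [/setIidPl -> // | e].
  by apply/setIidPl/eqP; rewrite eqEcard subsetIl e leqnn.
have [eab|nab] := eqVneq a b.
  subst b; rewrite eqxx in h; split=> [e|[/sub_cap e _]]; last by lia.
  by split; [apply/sub_cap; lia | right].
have [ea|na] := eqVneq a ord0.
  have nb : b != ord0 by rewrite -ea eq_sym.
  rewrite nab in h; rewrite nb in cA; rewrite ea eqxx in cX.
  split=> [e|[/sub_cap e _]]; last by lia.
  by split; [apply/sub_cap; lia | left].
split=> [e|[_ []]]; last 2 first.
- by move/eqP; rewrite (negPf na).
- by move/eqP; rewrite (negPf nab).
by rewrite nab in h; rewrite na in cX; move: cA; case: (b != ord0); lia.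
Qed.

(** * Blocks sorted by their last letter *)

(** The supports of the blocks with last letter [a]; treating [R] as the family
    of letter [0] puts both kinds of blocks on the same footing. *)
Definition letter_blocks (n r : nat) (R : {set {set 'I_n}})
    (T : 'I_r -> {set {set 'I_n}}) (a : 'I_r.+1) : {set {set 'I_n}} :=
  if unlift ord0 a is Some i then T i else R.

Lemma letter_blocks0 (n r : nat) (R : {set {set 'I_n}})
    (T : 'I_r -> {set {set 'I_n}}) : letter_blocks R T ord0 = R.
Proof. by rewrite /letter_blocks unlift_none. Qed.

Lemma letter_blocks_lift (n r : nat) (R : {set {set 'I_n}})
    (T : 'I_r -> {set {set 'I_n}}) (i : 'I_r) :
  letter_blocks R T (lift ord0 i) = T i.
Proof. by rewrite /letter_blocks liftK. Qed.

Lemma mem_extended_blocks (n r : nat) (R : {set {set 'I_n}})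
    (T : 'I_r -> {set {set 'I_n}}) (A : {set 'I_n}) (a : 'I_r.+1) :
  (word_of A a \in extended_blocks R T) = (A \in letter_blocks R T a).
Proof.
apply/setUP/idP => [[/imsetP[B RB]|/bigcupP[i _ /imsetP[B TB]]]|].
- by case/word_of_inj => -> ->; rewrite letter_blocks0.
- by case/word_of_inj => -> ->; rewrite letter_blocks_lift.
case: (unliftP ord0 a) => [i|] ->.
  rewrite letter_blocks_lift => TA; right; apply/bigcupP.
  by exists i => //; apply/imsetP; exists A.
by rewrite letter_blocks0 => RA; left; apply/imsetP; exists A.
Qed.

Lemma letter_blocks_card (n r t k : nat) (R : {set {set 'I_n}})
    (T : 'I_r -> {set {set 'I_n}}) (k_gt0 : 0 < k)
    (R_size : forall A : {set 'I_n}, A \in R -> #|A| = k)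
    (T_steiner : forall i : 'I_r, steiner_system (t - 1) (k - 1) (T i))
    (A : {set 'I_n}) (a : 'I_r.+1) :
  A \in letter_blocks R T a -> #|A| + (a != ord0) = k.
Proof.
case: (unliftP ord0 a) => [i|] ->.
  by rewrite letter_blocks_lift => /(proj1 (T_steiner i)) ->; rewrite subnK.
by rewrite letter_blocks0 eqxx addn0 => /R_size.
Qed.

Lemma exists_pred_tset_block (n r t k : nat) (R : {set {set 'I_n}})
    (T : 'I_r -> {set {set 'I_n}})
    (T_steiner : forall i : 'I_r, steiner_system (t - 1) (k - 1) (T i))
    (X : {set 'I_n}) (a : 'I_r.+1) :
  a != ord0 -> #|X| = t - 1 ->
  exists2 A, A \in letter_blocks R T a & X \subset A.
Proof.
case: (unliftP ord0 a) => [i|] -> //; rewrite letter_blocks_lift => _ cX.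
by have [A [[TA sXA] _]] := proj2 (T_steiner i) X cX; exists A.
Qed.

Lemma block_determined_by_pred_tset (n r t k : nat) (R : {set {set 'I_n}})
    (T : 'I_r -> {set {set 'I_n}})
    (T_steiner : forall i : 'I_r, steiner_system (t - 1) (k - 1) (T i))
    (A B : {set 'I_n}) (a : 'I_r.+1) :
  a != ord0 -> A \in letter_blocks R T a -> B \in letter_blocks R T a ->
  t - 1 <= #|A :&: B| -> A = B.
Proof.
case: (unliftP ord0 a) => [i|] -> //; rewrite letter_blocks_lift => _ TA TB.
case/exists_subset_card => X; rewrite subsetI => /andP[sXA sXB] cX.
have [C [_ uC]] := proj2 (T_steiner i) X cX.
by rewrite -(uC A) ?(uC B).
Qed.

(** A [t]-set common to two blocks with different letters would be covered by
    both [R] and some [T i], against [T_avoids], or by two distinct [T i], against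
    [T_covers].  With equal letters, the packing property settles [R], and a
    Steiner system [T i] has a single block even through [t - 1] points. *)
Lemma block_determined_by_tset (n r t k : nat) (R : {set {set 'I_n}})
    (T : 'I_r -> {set {set 'I_n}})
    (R_packing : forall X : {set 'I_n}, #|X| = t ->
       forall A A' : {set 'I_n}, A \in R -> A' \in R ->
       X \subset A -> X \subset A' -> A = A')
    (T_steiner : forall i : 'I_r, steiner_system (t - 1) (k - 1) (T i))
    (T_covers : forall X : {set 'I_n}, #|X| = t -> ~ covered X R ->
       exists! i : 'I_r, covered X (T i))
    (T_avoids : forall X : {set 'I_n}, #|X| = t -> covered X R ->
       forall i : 'I_r, ~ covered X (T i))
    (A B : {set 'I_n}) (a b : 'I_r.+1) :
  A \in letter_blocks R T a -> B \in letter_blocks R T b ->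
  t <= #|A :&: B| -> A = B /\ a = b.
Proof.
move=> FA FB le_t.
have le_t1 : t - 1 <= #|A :&: B| by apply: leq_trans le_t; apply: leq_subr.
case/exists_subset_card: (le_t) => X; rewrite subsetI => /andP[sXA sXB] cX.
have eab : a = b.
  move: FA FB; case: (unliftP ord0 a) => [i|] ->; case: (unliftP ord0 b) => [j|] ->;
    rewrite ?letter_blocks0 ?letter_blocks_lift // => FA FB.
  - have Ti : covered X (T i) by exists A.
    have Tj : covered X (T j) by exists B.
    case: (T_covers X cX) => [RX|l [_ ul]]; first by case: (T_avoids X cX RX i).
    by rewrite -(ul i Ti) (ul j Tj).
  - by case: (T_avoids X cX _ i); [exists B | exists A].
  - by case: (T_avoids X cX _ j); [exists A | exists B].
subst b; split=> //; have [ea|na] := eqVneq a ord0.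
  by move: FA FB; rewrite ea letter_blocks0 => RA RB; apply: (R_packing X cX).
exact: (block_determined_by_pred_tset T_steiner na FA FB le_t1).
Qed.

Lemma exists_tset_block (n r t : nat) (R : {set {set 'I_n}})
    (T : 'I_r -> {set {set 'I_n}})
    (T_covers : forall X : {set 'I_n}, #|X| = t -> ~ covered X R ->
       exists! i : 'I_r, covered X (T i))
    (X : {set 'I_n}) : #|X| = t ->
  exists a, exists2 A, A \in letter_blocks R T a & X \subset A.
Proof.
move=> cX; have [/exists_inP[A RA sXA]|nRX] := boolP [exists A in R, X \subset A].
  by exists ord0; exists A; rewrite ?letter_blocks0.
case: (T_covers X cX) => [[A RA sXA]|i [[A TA sXA] _]].
  by case/exists_inP: nRX; exists A.
by exists (lift ord0 i); exists A; rewrite ?letter_blocks_lift.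
Qed.

(** * Distances and covering in the extended system *)

Theorem theorem9 (n r t k : nat) (R : {set {set 'I_n}})
    (T : 'I_r -> {set {set 'I_n}})
    (t_gt0 : 0 < t) (le_tk : t <= k) (le_kn : k <= n.+1)
    (R_size : forall A : {set 'I_n}, A \in R -> #|A| = k)
    (R_packing : forall X : {set 'I_n}, #|X| = t ->
       forall A A' : {set 'I_n}, A \in R -> A' \in R ->
       X \subset A -> X \subset A' -> A = A')
    (T_steiner : forall i : 'I_r, steiner_system (t - 1) (k - 1) (T i))
    (T_disjoint : forall i j : 'I_r, i != j -> [disjoint T i & T j])
    (T_covers : forall X : {set 'I_n}, #|X| = t -> ~ covered X R ->
       exists! i : 'I_r, covered X (T i))
    (T_avoids : forall X : {set 'I_n}, #|X| = t -> covered X R ->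
       forall i : 'I_r, ~ covered X (T i)) :
  mixed_steiner_system t k (extended_blocks R T).
Proof.
have k_gt0 : 0 < k by apply: leq_trans le_tk.
have sizeF := letter_blocks_card k_gt0 R_size T_steiner.
have uniq_t := block_determined_by_tset R_packing T_steiner T_covers T_avoids.
have uniq_t1 := block_determined_by_pred_tset (R := R) T_steiner.
have dist_lb : distance_ge (extended_blocks R T) (2 * (k - t) + 1).
  move=> c c'; have [A [a ->]] := word_of_surj c.
  have [B [b ->]] := word_of_surj c'; rewrite !mem_extended_blocks => FA FB ncc.
  have h := hamming_word_of A B a b.
  have cA := sizeF A a FA; have cB := sizeF B b FB.
  have capt : #|A :&: B| < t.
    by rewrite ltnNge; apply: contra ncc => /(uniq_t _ _ _ _ FA FB)[-> ->].
  have [eab|nab] := eqVneq a b; last by rewrite nab in h; lia.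
  subst b; rewrite eqxx in h; have [ea|na] := eqVneq a ord0.
    by rewrite ea eqxx in cA cB; lia.
  have capt1 : #|A :&: B| < t - 1.
    by rewrite ltnNge; apply: contra ncc => /(uniq_t1 _ _ _ na FA FB) ->.
  by rewrite na in cA cB; lia.
split=> //.
- move=> c; have [A [a ->]] := word_of_surj c.
  by rewrite mem_extended_blocks weight_word_of; apply: sizeF.
- move=> x; have [X [a ->]] := word_of_surj x; rewrite weight_word_of => cX.
  have [b [A [FA sXA eab]]] : exists b, exists A,
      [/\ A \in letter_blocks R T b, X \subset A & a = ord0 \/ a = b].
    have [ea|na] := eqVneq a ord0.
      rewrite ea eqxx addn0 in cX.
      by have [b [A FA sXA]] := exists_tset_block T_covers cX;
        exists b, A; split=> //; left.
    have cX1 : #|X| = t - 1 by rewrite na in cX; lia.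
    have [A FA sXA] := exists_pred_tset_block R T_steiner na cX1.
    by exists a, A; split=> //; right.
  exists (word_of A b); split.
    rewrite mem_extended_blocks; split=> //.
    by apply/(hamming_eq_cover le_tk cX (sizeF _ _ FA)).
  move=> c; have [B [d ->]] := word_of_surj c.
  rewrite mem_extended_blocks => -[FB].
  case/(hamming_eq_cover le_tk cX (sizeF _ _ FB)) => sXB ead.
  have le_cap : #|X| <= #|A :&: B| by rewrite subset_leq_card // subsetI sXA.
  have [ea|na] := eqVneq a ord0.
    rewrite ea eqxx addn0 in cX; rewrite cX in le_cap.
    by have [-> ->] := uniq_t _ _ _ _ FA FB le_cap.
  have eb : a = b by case: eab na => [->|//]; rewrite eqxx.
  have ed : a = d by case: ead na => [->|//]; rewrite eqxx.
  subst b d; rewrite (uniq_t1 _ _ _ na FA FB) //.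
  by rewrite na in cX; lia.
- case=> -[j|] //= r_gt1; split=> //.
  (* An alphabet with more than two letters can only be the last one, so there
     are two nonzero letters.  Their blocks through a common (t - 1)-set X meet
     in no t-set, hence exactly in X, which makes the distance minimal. *)
  have r0 : 0 < r by lia.
  have r1 : 1 < r by lia.
  set a : 'I_r.+1 := lift ord0 (Ordinal r0).
  set b : 'I_r.+1 := lift ord0 (Ordinal r1).
  have nab : a != b by [].
  have na : a != ord0 by [].
  have nb : b != ord0 by [].
  have [X _ cX] : exists2 X : {set 'I_n}, X \subset setT & #|X| = t - 1.
    by apply: exists_subset_card; rewrite cardsT card_ord; lia.
  have [A FA sXA] := exists_pred_tset_block R T_steiner na cX.
  have [B FB sXB] := exists_pred_tset_block R T_steiner nb cX.
  have le_cap : t - 1 <= #|A :&: B|.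
    by rewrite -cX subset_leq_card // subsetI sXA.
  have capt : #|A :&: B| < t.
    by rewrite ltnNge; apply: contra nab => /(uniq_t _ _ _ _ FA FB)[_ ->].
  exists (word_of A a), (word_of B b); split; rewrite ?mem_extended_blocks //.
    by apply: contra nab => /eqP/word_of_inj[_ ->].
  have h := hamming_word_of A B a b.
  have cA := sizeF A a FA; have cB := sizeF B b FB.
  by rewrite na in cA; rewrite nb in cB; rewrite nab in h; lia.
Qed.
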